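(* Let $G$ be a finite simple graph. Then $G$ is probe diamond-free if and only if all of the following hold: (i) $G$ is locally union of complete split (LUCS); (ii) $G$ is $\overline{P_3+K_2}$-free; (iii) the set $N_G$ is an independent set of $G$; and (iv) the auxiliary bipartite graph $G_B$ contains no induced cycle of length $6$.
   Context: A diamond is $K_4$ minus one edge; its tips are the two nonadjacent vertices. A graph $G=(V,E)$ is probe diamond-free if $V$ admits a partition $V=P\cup N$ with $N$ an independent set, and there is a set $F$ of non-edges of $G$ with both endpoints in $N$ such that $(V,E\cup F)$ has no induced diamond. A graph is $H$-free if it has no induced subgraph isomorphic to $H$; $\overline{H}$ is the complement and $+$ is disjoint union. A graph is complete split if its vertex set can be partitioned into a clique $K$ and a maximum independent set $S$ with every vertex of $K$ adjacent to every vertex of $S$; $(K,S)$ is a complete split partition (unique when the graph is connected and $|S|\ge 2$). $G$ is LUCS if for every vertex $v$, every connected component of $G[N(v)]$ is complete split. For a LUCS graph, for a vertex $w$ and a connected component $C_w$ of $G[N(w)]$ with complete split partition $(K_{C_w},S_{C_w})$, call $C_w$ non-special if $|S_{C_w}|\ge 2$. $F_G$ is the set of non-edges $uv$ with $u,v\in S_{C_w}$ for some vertex $w$ and some component $C_w$ of $G[N(w)]$, and $N_G$ is the set of endpoints of pairs in $F_G$. Given a bijection $\phi:V(G)\to\{0,\dots,|V(G)|-1\}$, the bipartite graph $G_B$ has one side $N_G$ and the other side $A_B$, where for each vertex $v$ and each non-special component $C_v$ of $G[N(v)]$ with $\phi(v)<\phi(x)$ for all $x\in K_{C_v}$ one adds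 a new vertex to $A_B$ adjacent exactly to the vertices of $S_{C_v}$; up to isomorphism $G_B$ does not depend on $\phi$. *)

(* Defs.v *)
(* Mathematical Components.  A finite simple graph is a symmetric irreflexive
   relation on a finType. *)
From mathcomp Require Import all_boot.

Set Implicit Arguments.
Unset Strict Implicit.
Unset Printing Implicit Defensive.

Definition complete_graph n : rel 'I_n := [rel i j : 'I_n | i != j].

Definition path_graph n : rel 'I_n :=
  [rel i j : 'I_n | (i.+1 == j :> nat) || (j.+1 == i :> nat)].

(* The n-cycle when 3 <= n. *)
Definition cycle_graph n : rel 'I_n :=
  [rel i j : 'I_n | (i.+1 %% n == j) || (j.+1 %% n == i)].

(* The tips are 0 and 1. *)
Definition diamond : rel 'I_4 :=
  [rel i j : 'I_4 | (i != j) && ((i : nat, j : nat) \notin [:: (0, 1); (1, 0)])].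

Definition graph_compl (U : eqType) (h : rel U) : rel U :=
  [rel x y | (x != y) && ~~ h x y].

Definition graph_union (U W : Type) (h : rel U) (k : rel W) : rel (U + W) :=
  fun a b => match a, b with
             | inl x, inl y => h x y
             | inr x, inr y => k x y
             | _, _ => false
             end.

Definition has_induced (U W : Type) (h : rel U) (e : rel W) : Prop :=
  exists2 f : U -> W, injective f & forall x y, e (f x) (f y) = h x y.

Definition free_of (U W : Type) (h : rel U) (e : rel W) : Prop :=
  ~ has_induced h e.

Section Graph.

Variables (T : finType) (e : rel T).

Definition nbh (v : T) : {set T} := [set x | e v x].

Definition is_clique (A : {set T}) : bool :=
  [forall x in A, forall y in A, (x != y) ==> e x y].

Definition is_stable (A : {set T}) : bool :=
  [forall x in A, forall y in A, ~~ e x y].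

Definition max_stable_in (C S : {set T}) : bool :=
  [&& S \subset C, is_stable S
    & [forall S' : {set T}, (S' \subset C) && is_stable S' ==> (#|S'| <= #|S|)]].

Definition components (A : {set T}) : {set {set T}} :=
  equivalence_partition
    (connect [rel x y | [&& x \in A, y \in A & e x y]]) A.

(* (K, S) is a complete split partition of the subgraph induced by C. *)
Definition cs_partition (C K S : {set T}) : bool :=
  [&& K :|: S == C, [disjoint K & S], is_clique K, max_stable_in C S
    & [forall x in K, forall y in S, e x y]].

Definition complete_split (C : {set T}) : bool :=
  [exists K : {set T}, exists S : {set T}, cs_partition C K S].

Definition LUCS : Prop :=
  forall v C, C \in components (nbh v) -> complete_split C.

(* For a connected C the partition is unique unless #|S| = 1 (C a clique); the
   choice made in that case is irrelevant below, where only components with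
   1 < #|S| contribute.  The default value is used only when C is not complete
   split. *)
Definition cs_pair (C : {set T}) : {set T} * {set T} :=
  odflt (set0, set0) [pick KS | cs_partition C KS.1 KS.2].

Definition Kpart (C : {set T}) : {set T} := (cs_pair C).1.
Definition Spart (C : {set T}) : {set T} := (cs_pair C).2.

Definition non_special (C : {set T}) : bool := 1 < #|Spart C|.

Definition FG : rel T :=
  [rel u v | [&& u != v, ~~ e u v
    & [exists w : T, exists C in components (nbh w),
         (u \in Spart C) && (v \in Spart C)]]].

Definition NG : {set T} := [set u | [exists v, FG u v]].

Definition AB (phi : T -> 'I_#|T|) : {set T * {set T}} :=
  [set p | [&& p.2 \in components (nbh p.1), non_special p.2
             & [forall x in Kpart p.2, phi p.1 < phi x]]].

Definition GB_vertex (phi : T -> 'I_#|T|) : Type :=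
  ({x : T | x \in NG} + {p : T * {set T} | p \in AB phi})%type.

Definition GB (phi : T -> 'I_#|T|) : rel (GB_vertex phi) :=
  fun a b => match a, b with
             | inl x, inr p => val x \in Spart (val p).2
             | inr p, inl x => val x \in Spart (val p).2
             | _, _ => false
             end.

Definition probe_diamond_free : Prop :=
  exists (P N : {set T}) (F : rel T),
    [/\ P :|: N = [set: T], [disjoint P & N], is_stable N,
        symmetric F /\
        (forall x y, F x y -> [&& x \in N, y \in N, x != y & ~~ e x y])
      & free_of diamond [rel x y | e x y || F x y]].

End Graph.

(* Main.v *)
(** In a probe diamond-free graph, neighbourhoods in the completed graph G + F
    are disjoint unions of cliques, so each component C of G[N(v)] is complete
    split with stable side C :&: N, and F contains all of F_G.  Conversely one
    completes G with F_G itself: its pairs are the tips of the diamonds of G,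
    (ii) makes the common neighbourhood of such a pair a clique, and (iv) puts
    any triangle of F_G-pairs inside the stable side of a single component;
    each way of using F_G-pairs in a diamond of G + F_G is then excluded. *)
Require Import Defs.
From mathcomp Require Import all_boot.

Set Implicit Arguments.
Unset Strict Implicit.
Unset Printing Implicit Defensive.

(** * The three forbidden induced subgraphs, in terms of named vertices *)

Lemma has_induced_diamond (T : eqType) (e : rel T) :
  symmetric e -> irreflexive e ->
  has_induced diamond e <->
  exists a b c d, [/\ a != b, ~~ e a b, e c d, e a c && e a d & e b c && e b d].
Proof.
move=> e_sym e_irr; split=> [[f f_inj fE]|[a [b [c [d [ab nab cd]]]]]].
  have fN i j : i != j -> f i != f j by rewrite (inj_eq f_inj).
  exists (f (inord 0)), (f (inord 1)), (f (inord 2)), (f (inord 3)).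
  by rewrite fN -?val_eqE ?fE /diamond /= -?val_eqE /= ?inordK.
case/andP=> ac ad /andP[bc bd].
have ne x y : e x y -> x != y by apply: contraTneq => ->; rewrite e_irr.
exists (tnth [tuple a; b; c; d]).
  by apply/tuple_uniqP; rewrite /= !inE !negb_or ab !ne.
move=> [[|[|[|[|i]]]] li] [[|[|[|[|j]]]] lj] //;
  rewrite !(tnth_nth a) /diamond /= ?e_irr //;
  by rewrite ?cd ?ac ?ad ?bc ?bd ?(negPf nab) // e_sym
             ?cd ?ac ?ad ?bc ?bd ?(negPf nab).
Qed.

(** The path has middle vertex [b], so complementing leaves [ac] as its only edge; [d], [d'] form
    the $K_2$, made nonadjacent and joined to [a], [b], [c]. *)
Lemma has_induced_compl_P3K2 (T : eqType) (e : rel T) :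
  symmetric e -> irreflexive e ->
  has_induced (graph_compl (graph_union (@path_graph 3) (@complete_graph 2))) e <->
  exists a b c d d', [/\ e a c, ~~ e a b && ~~ e b c, (d != d') && ~~ e d d',
    [&& e d a, e d b & e d c] & [&& e d' a, e d' b & e d' c]].
Proof.
move=> e_sym e_irr; split=> [[f f_inj fE]|[a [b [c [d [d' []]]]]]].
  have fN i j : i != j -> f i != f j by rewrite (inj_eq f_inj).
  exists (f (inl (inord 0))), (f (inl (inord 1))), (f (inl (inord 2))).
  exists (f (inr (inord 0))), (f (inr (inord 1))).
  by rewrite fN -?val_eqE ?fE /graph_compl /path_graph /complete_graph /=
     /eq_op /= -?val_eqE /= ?inordK.
move=> ac /andP[nab nbc] /andP[dd' ndd'] /and3P[da db dc] /and3P[d'a d'b d'c].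
have ne x y : e x y -> x != y by apply: contraTneq => ->; rewrite e_irr.
have ab : a != b by apply: contraNneq nbc => <-.
have bc : b != c by apply: contraNneq nab => ->.
pose f (i : 'I_3 + 'I_2) := match i with
  | inl i => tnth [tuple a; b; c] i | inr i => tnth [tuple d; d'] i end.
exists f.
  have abc_inj : injective (tnth [tuple a; b; c]).
    by apply/tuple_uniqP; rewrite /= !inE !negb_or ab bc ne.
  have dd'_inj : injective (tnth [tuple d; d']).
    by apply/tuple_uniqP; rewrite /= !inE dd'.
  have abc_dd' i j : e (tnth [tuple d; d'] j) (tnth [tuple a; b; c] i).
    by case: i j => [[|[|[|i]]] li] [[|[|j]] lj] //; rewrite !(tnth_nth a).
  move=> [i|i] [j|j] /= fij; first by rewrite (abc_inj _ _ fij).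
  - by have := abc_dd' i j; rewrite fij e_irr.
  - by have := abc_dd' j i; rewrite fij e_irr.
  - by rewrite (dd'_inj _ _ fij).
by move=> [[[|[|[|i]]] li]|[[|[|i]] li]] [[[|[|[|j]]] lj]|[[|[|j]] lj]] //;
  rewrite /f !(tnth_nth a) /graph_compl /eq_op /= ?e_irr //
    ?ac ?da ?db ?dc ?d'a ?d'b ?d'c ?(negPf nab) ?(negPf nbc) ?(negPf ndd') //
    e_sym
    ?ac ?da ?db ?dc ?d'a ?d'b ?d'c ?(negPf nab) ?(negPf nbc) ?(negPf ndd').
Qed.

Lemma has_induced_C6_GB (T : finType) (e : rel T) (phi : T -> 'I_#|T|) :
  has_induced (@cycle_graph 6) (@GB T e phi) <->
  exists (x y z : T) (p q r : T * {set T}),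
    [/\ [&& x \in NG e, y \in NG e & z \in NG e],
        [&& p \in AB e phi, q \in AB e phi & r \in AB e phi],
        [&& x \in Spart e p.2, y \in Spart e p.2 & z \notin Spart e p.2],
        [&& y \in Spart e q.2, z \in Spart e q.2 & x \notin Spart e q.2]
      & [&& z \in Spart e r.2, x \in Spart e r.2 & y \notin Spart e r.2]].
Proof.
split=> [[f _ fE]|[x [y [z [p [q [r []]]]]]]].
  have E i j : i < 6 -> j < 6 -> GB (f (inord i)) (f (inord j)) =
      (i.+1 %% 6 == j) || (j.+1 %% 6 == i).
    by move=> li lj; rewrite fE /cycle_graph /= !inordK.
  (* The cycle edges force the two sides to alternate; the antipodal non-edges give the three
     [\notin] conditions. Two cases remain, by the side of vertex 0. *)
  move: (E 0 1 isT isT) (E 1 2 isT isT) (E 2 3 isT isT) (E 3 4 isT isT)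
    (E 4 5 isT isT) (E 5 0 isT isT) (E 0 3 isT isT) (E 1 4 isT isT)
    (E 2 5 isT isT) => /=.
  move: (f _) (f _) (f _) (f _) (f _) (f _).
  move=> [[x0 ?]|[p0 ?]] [[x1 ?]|[p1 ?]] [[x2 ?]|[p2 ?]] [[x3 ?]|[p3 ?]]
    [[x4 ?]|[p4 ?]] [[x5 ?]|[p5 ?]] //=.
    move=> *; exists x0, x2, x4, p1, p3, p5.
    by split; apply/and3P; split=> //; apply/negbT.
  move=> *; exists x1, x3, x5, p2, p4, p0.
  by split; apply/and3P; split=> //; apply/negbT.
case/and3P=> xN yN zN /and3P[pA qA rA] /and3P[xp yp /negPf zp].
case/and3P=> yq zq /negPf xq /and3P[zr xr /negPf yr].
pose f : 'I_6 -> GB_vertex e phi := tnth [tuple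
  inl (exist _ x xN); inr (exist _ p pA); inl (exist _ y yN);
  inr (exist _ q qA); inl (exist _ z zN); inr (exist _ r rA)].
have fE i j : GB (f i) (f j) = cycle_graph i j.
  by case: i j => [[|[|[|[|[|[|i]]]]]] li] [[|[|[|[|[|[|j]]]]]] lj].
exists f => // i j fij.
(* Distinct vertices of the 6-cycle have distinct neighbourhoods. *)
have {fE} : [forall k, cycle_graph i k == cycle_graph j k].
  by apply/forallP=> k; rewrite -!fE fij.
move/forallP=> ij; apply/val_inj.
move: (ij (inord 0)) (ij (inord 1)) (ij (inord 2)) (ij (inord 3))
  (ij (inord 4)) (ij (inord 5)).
rewrite /cycle_graph /= !inordK //.
by case: i j {ij fij} => [[|[|[|[|[|[|i]]]]]] li] [[|[|[|[|[|[|j]]]]]] lj].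
Qed.

(** * Components of an induced subgraph *)

Section Components.

Variables (T : finType) (e : rel T).
Hypotheses (e_sym : symmetric e) (e_irr : irreflexive e).

Lemma componentsP (A C : {set T}) :
  reflect (exists2 x, x \in A &
             C = [set y in A | connect [rel y z | [&& y \in A, z \in A & e y z]] x y])
          (C \in components e A).
Proof. exact: imsetP. Qed.

Lemma component_sub (A C : {set T}) x :
  C \in components e A -> x \in C -> x \in A.
Proof. by case/componentsP=> y _ ->; rewrite inE => /andP[]. Qed.

Lemma component_closed (A C : {set T}) x y :
  C \in components e A -> x \in C -> y \in A -> e x y -> y \in C.
Proof.
case/componentsP=> z _ ->; rewrite !inE => /andP[xA zx] yA xy.
by rewrite yA (connect_trans zx) // connect1 //= xA yA.
Qed.

Lemma component_exists (A : {set T}) x :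
  x \in A -> exists2 C, C \in components e A & x \in C.
Proof.
move=> xA; set r := [rel y z | [&& y \in A, z \in A & e y z]].
exists [set y in A | connect r x y]; last by rewrite inE xA connect0.
by apply/componentsP; exists x.
Qed.

Lemma nbh_component v x :
  e v x -> exists2 C, C \in components e (nbh e v) & x \in C.
Proof. by move=> vx; apply: component_exists; rewrite inE. Qed.

(** Induction on a path connecting [x] to [y], removing its last edge. *)
Lemma component_ind (A C : {set T}) (R : rel T) :
  C \in components e A -> reflexive R ->
  (forall x y z, x \in A -> y \in A -> z \in A -> R x y -> e y z -> R x z) ->
  {in C &, forall x y, R x y}.
Proof.
case/componentsP=> z _ -> R_refl R_step x y.
rewrite !inE => /andP[xA zx] /andP[yA zy].
set r := [rel _ _ | _] in zx zy.
have r_sym : symmetric r by move=> u v; rewrite /= e_sym andbCA.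
have {zx zy} : connect r x y.
  by apply: connect_trans zy; rewrite (sym_connect_sym r_sym).
case/connectP=> p; elim/last_ind: p y yA => [|p w IH] y _ //=; first by move=> _ ->.
rewrite rcons_path last_rcons => /andP[xp /= /and3P[lA wA lw]] ->.
by apply: (R_step _ (last x p)) => //; apply: IH.
Qed.

Lemma component_neighbour (A C : {set T}) x y :
  C \in components e A -> x \in C -> y \in C -> x != y ->
  exists2 z, z \in C & e x z.
Proof.
move=> CA xC yC xy.
have : (x == y) || [exists z in A, e x z].
  apply: (component_ind (R := fun x y => (x == y) || [exists z in A, e x z]) CA)
    => // [u | u v w _ _ wA]; first by rewrite eqxx.
  case/orP=> [/eqP <- uw|-> _]; last by rewrite orbT.
  by apply/orP; right; apply/exists_inP; exists w.
rewrite (negPf xy) => /exists_inP[z zA xz]; exists z => //.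
exact: component_closed CA xC zA xz.
Qed.

(** Maximality of [S]: a stable subset of [C] meeting [C :\: S] is a single vertex, and [S] is
    nonempty. *)
Lemma cs_partition_setD (C S : {set T}) :
  S \subset C -> S != set0 -> is_stable e S ->
  {in C :\: S & C, forall x y, x != y -> e x y} -> cs_partition e C (C :\: S) S.
Proof.
move=> sSC S_n0 S_stable adj; apply/and5P; split.
- by rewrite setDE setUIl (setUC (~: S)) setUCr setIT; apply/eqP/setUidPl.
- by rewrite -setI_eq0 setIDAC setDIl setDv setI0.
- apply/forall_inP=> x xK; apply/forall_inP=> y; rewrite inE => /andP[_ yC].
  by apply/implyP; apply: adj.
- apply/and3P; split=> //; apply/forallP=> S'; apply/implyP=> /andP[sS'C S'_stable].
  have [/subset_leq_card //|/subsetPn[x xS' xS]] := boolP (S' \subset S).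
  have /subset_leq_card : S' \subset [set x].
    apply/subsetP=> y yS'; rewrite inE eq_sym; apply/contraT => /adj xy.
    have /negP[] := forall_inP (forall_inP S'_stable x xS') y yS'.
    by apply: xy; rewrite ?inE ?xS (subsetP sS'C).
  by rewrite cards1 => /leq_trans; apply; rewrite card_gt0.
- apply/forall_inP=> x xK; apply/forall_inP=> y yS.
  apply: adj; rewrite ?(subsetP sSC) //; apply: contraTneq yS => <-.
  by case/setDP: xK.
Qed.

(** * Clique and stable sides of a component in a LUCS graph *)

Section Lucs.

Hypothesis lucs : LUCS e.

Variables (v : T) (C : {set T}).
Hypothesis C_comp : C \in components e (nbh e v).

Lemma LUCS_cs : cs_partition e C (Kpart e C) (Spart e C).
Proof.
rewrite /Kpart /Spart /cs_pair; case: pickP => //= none.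
by case/existsP: (lucs C_comp) => K /existsP[S]; rewrite (none (K, S)).
Qed.

Lemma Spart_sub : Spart e C \subset C.
Proof. by case/and5P: LUCS_cs => _ _ _ /and3P[]. Qed.

Lemma Spart_stable : {in Spart e C &, forall x y, ~~ e x y}.
Proof.
case/and5P: LUCS_cs => _ _ _ /and3P[_ S_stable _] _ x y xS.
exact: (forall_inP (forall_inP S_stable x xS)).
Qed.

Lemma Kpart_Spart : {in Kpart e C & Spart e C, forall x y, e x y}.
Proof.
case/and5P: LUCS_cs => _ _ _ _ KS x y xK.
exact: (forall_inP (forall_inP KS x xK)).
Qed.

Lemma notin_Spart x : x \in C -> x \notin Spart e C -> x \in Kpart e C.
Proof.
case/and5P: LUCS_cs => /eqP defC _ _ _ _ xC xS.
by move: xC; rewrite -{1}defC inE (negPf xS) orbF.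
Qed.

(** A vertex of the clique side is adjacent to every other vertex of [C]. *)
Lemma nonadj_Spart x y :
  x \in C -> y \in C -> x != y -> ~~ e x y -> x \in Spart e C.
Proof.
move=> xC yC xy; apply: contraR => /(notin_Spart xC) xK.
have [/(Kpart_Spart xK) //|/(notin_Spart yC) yK] := boolP (y \in Spart e C).
case/and5P: LUCS_cs => _ _ K_clique _ _.
exact: (implyP (forall_inP (forall_inP K_clique x xK) y yK)).
Qed.

(** Connectedness gives [x] a neighbour [k] in [C], necessarily on the clique side; [vk] is then a
    diamond chord for every pair of the stable side. *)
Lemma Spart_common_edge x y : x \in Spart e C -> y \in Spart e C -> x != y ->
  exists2 k, e v k & forall z, z \in Spart e C -> e v z && e k z.
Proof.
move=> xS yS xy; have sSC := subsetP Spart_sub.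
have [k kC xk] := component_neighbour C_comp (sSC _ xS) (sSC _ yS) xy.
have kK : k \in Kpart e C.
  by apply: notin_Spart => //; apply: contraL xk; apply: Spart_stable.
exists k => [|z zS]; first by have := component_sub C_comp kC; rewrite inE.
rewrite (Kpart_Spart kK zS) andbT.
by have := component_sub C_comp (sSC _ zS); rewrite inE.
Qed.

End Lucs.

(** * Forbidden patterns in neighbourhoods, and [FG]-pairs as tips of diamonds *)

Section LucsTheory.

Hypothesis lucs : LUCS e.

(** Neighbourhoods have no induced $P_4$: nonadjacent [a], [c] are on the stable side, so [d],
    adjacent to [c], is on the clique side and sees [a]. *)
Lemma LUCS_P4 v a b c d : e v a -> e v b -> e v c -> e v d ->
  e a b -> e b c -> e c d -> a != c -> ~~ e a c -> e a d.
Proof.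
move=> va vb vc vd ab bc cd ac nac.
have [C CA aC] := nbh_component va.
have bC : b \in C by apply: component_closed CA aC _ ab; rewrite inE.
have cC : c \in C by apply: component_closed CA bC _ bc; rewrite inE.
have dC : d \in C by apply: component_closed CA cC _ cd; rewrite inE.
have aS := nonadj_Spart lucs CA aC cC ac nac.
have cS : c \in Spart e C.
  by apply: (nonadj_Spart lucs CA cC aC); rewrite 1?eq_sym 1?e_sym.
rewrite e_sym; apply: (Kpart_Spart lucs CA) aS.
apply: (notin_Spart lucs CA) => //.
by apply: contraL cd; apply: (Spart_stable lucs CA).
Qed.

(** If [ww'] were a non-edge, both [x] and [w] would be on the stable side of one component,
    although [xw] is an edge. *)
Lemma LUCS_C4 v x y w w' : e v x -> e v y -> e v w -> e v w' ->
  e x w -> e y w -> e x w' -> x != y -> ~~ e x y -> w != w' -> e w w'.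
Proof.
move=> vx vy vw vw' xw yw xw' xy nxy ww'; apply/contraT=> nww'.
have [C CA xC] := nbh_component vx.
have wC : w \in C by apply: component_closed CA xC _ xw; rewrite inE.
have w'C : w' \in C by apply: component_closed CA xC _ xw'; rewrite inE.
have yC : y \in C by apply: component_closed CA wC _ _; [rewrite inE | rewrite e_sym].
have xS := nonadj_Spart lucs CA xC yC xy nxy.
have wS := nonadj_Spart lucs CA wC w'C ww' nww'.
by rewrite (negPf (Spart_stable lucs CA xS wS)) in xw.
Qed.

Lemma FG_NG x y : FG e x y -> x \in NG e.
Proof. by move=> xy; rewrite inE; apply/existsP; exists y. Qed.

Lemma FG_sym : symmetric (FG e).
Proof.
move=> x y; rewrite /FG /= eq_sym e_sym; congr [&& _, _ & _].
by apply/eq_existsb=> w; apply/eq_existsb=> C; rewrite (andbC (x \in _)).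
Qed.

(** [FG]-pairs are exactly the tips of diamonds of [e]: for a chord [vk], the component of [k] in
    the neighbourhood of [v] contains both tips. *)
Lemma FGP x y :
  reflect [/\ x != y, ~~ e x y
            & exists v k, [/\ e v k, e v x && e v y & e k x && e k y]]
          (FG e x y).
Proof.
apply: (iffP and3P) => [[xy nxy]|[xy nxy [v [k [vk /andP[vx vy] /andP[kx ky]]]]]].
  case/existsP=> v /exists_inP[C CA /andP[xS yS]]; split=> //.
  have [k vk kS] := Spart_common_edge lucs CA xS yS xy.
  have [/andP[vx kx] /andP[vy ky]] := (kS x xS, kS y yS).
  by exists v, k; rewrite vk vx vy kx ky.
split=> //; apply/existsP; exists v.
have [C CA kC] := nbh_component vk.
have xC : x \in C by apply: component_closed CA kC _ kx; rewrite inE.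
have yC : y \in C by apply: component_closed CA kC _ ky; rewrite inE.
apply/exists_inP; exists C => //.
rewrite (nonadj_Spart lucs CA xC yC) //=.
by apply: (nonadj_Spart lucs CA yC xC); rewrite 1?eq_sym 1?e_sym.
Qed.

(** * Common neighbourhoods of [FG]-pairs *)

Hypothesis no_P3K2 :
  free_of (graph_compl (graph_union (@path_graph 3) (@complete_graph 2))) e.

(** Let [vk] be the chord of a diamond with tips [x], [y]. Every other common neighbour is adjacent
    to [v]; inside the neighbourhood of [v], [LUCS_C4] then makes any two of them adjacent. *)
Lemma FG_common_nbh_clique x y w w' : FG e x y ->
  e w x && e w y -> e w' x && e w' y -> w != w' -> e w w'.
Proof.
case/FGP=> xy nxy [v [k [vk /andP[vx vy] /andP[kx ky]]]].
have v_adj z : e z x && e z y -> z != v -> e z v.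
  case/andP=> zx zy zv; rewrite e_sym; apply/contraT=> nvz.
  have [zk|nzk] := boolP (e k z).
    by rewrite -(negPf nvz); apply: (@LUCS_C4 k x y); rewrite 1?(eq_sym v) // e_sym.
  (* Here the edge [vk], the vertex [z] seeing neither end, and the non-edge [xy] induce the
     forbidden subgraph. *)
  case: no_P3K2; apply/(has_induced_compl_P3K2 e_sym e_irr).
  by exists v, z, k, x, y; rewrite xy nxy nvz vk ![e _ k]e_sym nzk kx ky
    ![e _ v]e_sym vx vy ![e _ z]e_sym zx zy.
move=> wM w'M ww'.
have [wv|wv] := eqVneq w v; first by rewrite e_sym wv v_adj // -wv eq_sym.
have [w'v|w'v] := eqVneq w' v; first by rewrite w'v v_adj.
case/andP: (wM) (w'M) => wx wy /andP[w'x w'y].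
apply: (@LUCS_C4 v x y) => //; first by rewrite e_sym v_adj.
- by rewrite e_sym v_adj.
- by rewrite e_sym.
- by rewrite e_sym.
- by rewrite e_sym.
Qed.

Lemma FG_common_edge x y d : FG e x y -> e d x && e d y ->
  exists2 m, e d m & e m x && e m y.
Proof.
move=> xyF dM; case/FGP: (xyF) => _ _ [v [k [vk vM kM]]].
have [dv|dv] := eqVneq d v; first by exists k; rewrite // dv.
by exists v => //; apply: FG_common_nbh_clique xyF _ _ _.
Qed.

(** * Triangles of [FG]-pairs and 6-cycles of [GB] *)

Variable phi : T -> 'I_#|T|.
Hypothesis phi_inj : injective phi.

(* The pair in [AB] is represented by the [phi]-least common neighbour. *)
Lemma FG_AB x y : FG e x y ->
  exists2 p, p \in AB e phi & (x \in Spart e p.2) && (y \in Spart e p.2).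
Proof.
move=> xyF; have [xy nxy [v0 [_ [_ v0M _]]]] := FGP _ _ xyF.
case: (arg_minnP (P := fun v => e v x && e v y) phi v0M) => v vM v_min.
have [k vk /andP[kx ky]] := FG_common_edge xyF vM.
have [C CA kC] := nbh_component vk.
case/andP: (vM) => vx vy.
have xC : x \in C by apply: component_closed CA kC _ kx; rewrite inE.
have yC : y \in C by apply: component_closed CA kC _ ky; rewrite inE.
have xS := nonadj_Spart lucs CA xC yC xy nxy.
have yS : y \in Spart e C.
  by apply: (nonadj_Spart lucs CA yC xC); rewrite 1?eq_sym 1?e_sym.
have KC z : z \in Kpart e C -> z \in C.
  by case/and5P: (LUCS_cs lucs CA) => /eqP defC _ _ _ _ zK; rewrite -defC inE zK.
exists (v, C); rewrite /= ?xS // inE CA /=; apply/andP; split.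
  by apply/card_gt1P; exists x, y.
(* A vertex of [Kpart] is itself a common neighbour of [x] and [y], so minimality gives
   [phi v <= phi z]; strictness uses [z != v] and injectivity. *)
apply/forall_inP=> z zK; rewrite ltn_neqAle v_min ?(Kpart_Spart lucs CA) // andbT.
have := component_sub CA (KC z zK); rewrite inE.
by apply: contraTneq => /val_inj/phi_inj <-; rewrite e_irr.
Qed.

Hypothesis no_C6 : free_of (@cycle_graph 6) (@GB T e phi).

(** Each pair lies in the stable side of some member of [AB]. If none of the three sides contains
    the third vertex, these members form a 6-cycle of [GB] with [x], [y], [z]. *)
Lemma FG_triangle_common_edge x y z : FG e x y -> FG e y z -> FG e z x ->
  exists v k, [/\ e v k, [&& e v x, e v y & e v z] & [&& e k x, e k y & e k z]].
Proof.
move=> xyF yzF zxF.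
have common p : p \in AB e phi ->
    [&& x \in Spart e p.2, y \in Spart e p.2 & z \in Spart e p.2] ->
  exists v k, [/\ e v k, [&& e v x, e v y & e v z] & [&& e k x, e k y & e k z]].
  rewrite inE => /and3P[CA _ _] /and3P[xS yS zS].
  have xy : x != y by case/FGP: xyF.
  have [k vk kS] := Spart_common_edge lucs CA xS yS xy.
  have [/andP[vx kx] /andP[vy ky] /andP[vz kz]] := And3 (kS x xS) (kS y yS) (kS z zS).
  by exists p.1, k; rewrite vk vx vy vz kx ky kz.
have [[p pA /andP[xp yp]] [q qA /andP[yq zq]]] := (FG_AB xyF, FG_AB yzF).
have [r rA /andP[zr xr]] := FG_AB zxF.
have [zp|zp] := boolP (z \in Spart e p.2); first by apply: (common p); rewrite ?xp ?yp.
have [xq|xq] := boolP (x \in Spart e q.2); first by apply: (common q); rewrite ?xq ?yq.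
have [yr|yr] := boolP (y \in Spart e r.2); first by apply: (common r); rewrite ?xr ?yr.
case: no_C6; apply/has_induced_C6_GB; exists x, y, z, p, q, r.
by rewrite (FG_NG xyF) (FG_NG yzF) (FG_NG zxF) pA qA rA xp yp zp yq zq xq zr xr yr.
Qed.

(** For a common edge [vk] of the triangle, [w] is [v] or adjacent to it; in the latter case
    [LUCS_P4] applies to the path [x], [k], [y], [w] in the neighbourhood of [v]. *)
Lemma FG_triangle_nbh x y z w : FG e x y -> FG e y z -> FG e z x ->
  e w y && e w z -> e w x.
Proof.
move=> xyF yzF zxF wM; rewrite e_sym.
have [v [k [vk /and3P[vx vy vz] /and3P[kx ky kz]]]] :=
  FG_triangle_common_edge xyF yzF zxF.
have vM : e v y && e v z by rewrite vy.
have [->|wv] := eqVneq w v; first by rewrite e_sym.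
have vw : e v w by rewrite e_sym (FG_common_nbh_clique yzF).
case/FGP: xyF => xy nxy _; case/andP: wM => wy _.
by apply: (@LUCS_P4 v x k y w) => //; rewrite e_sym.
Qed.

(** * The completion by [FG] has no induced diamond *)

Hypothesis NG_stable : is_stable e (NG e).

Lemma FG_completion_diamond_free : free_of diamond [rel x y | e x y || FG e x y].
Proof.
have st : {in NG e &, forall x y, ~~ e x y}.
  by move=> x y xN; apply: (forall_inP (forall_inP NG_stable x xN)).
(* Stability of [NG] separates the two kinds of edges: inside [NG] only [FG]-pairs occur, and every
   other edge of the completion lies in [e]. *)
have F_E u w z : FG e u w -> e z u -> z \notin NG e.
  by move=> /FG_NG uN; apply: contraL => zN; apply: st.
have F_F u w z : FG e u w -> z \in NG e -> e z u || FG e z u -> FG e z u.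
  by move=> /FG_NG uN zN; rewrite (negPf (st _ _ zN uN)).
have F_e u w z : FG e u w -> z \notin NG e -> e z u || FG e z u -> e z u.
  by move=> uw zN /orP[//|/FG_NG]; rewrite (negPf zN).
have G_sym : symmetric [rel x y | e x y || FG e x y].
  by move=> x y; rewrite /= e_sym FG_sym.
have G_irr : irreflexive [rel x y | e x y || FG e x y].
  by move=> x; rewrite /= e_irr /FG /= eqxx.
case/(has_induced_diamond G_sym G_irr) => a [b [c [d []]]] /= ab.
rewrite negb_or => /andP[nab nFab] cd /andP[ac ad] /andP[bc bd].
(* A mixed diamond: one of its rim edges is an [FG]-pair, its chord is not. *)
have rim u w s t : FG e u s -> e s t -> u != w -> ~~ e u w ->
    e u t || FG e u t -> e w s || FG e w s -> e w t || FG e w t -> FG e u w.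
  move=> usF st_ uw nuw ut ws wt.
  have sF : FG e s u by rewrite FG_sym.
  have tN : t \notin NG e by apply: (F_E _ _ _ sF); rewrite e_sym.
  have tE z : e z t || FG e z t -> e t z.
    by rewrite e_sym FG_sym => zt; have /orP[//|/FG_NG] := zt; rewrite (negPf tN).
  have [tu tw] := (tE _ ut, tE _ wt).
  have ts : e t s by rewrite e_sym.
  have [m tm /andP[mu ms]] := FG_common_edge usF (introT andP (conj tu ts)).
  have [us nus _] := FGP _ _ usF.
  (* If [w] is outside [NG], the path [u], [m], [s], [w] around [t] yields the edge [uw]. Otherwise
     [u], [m], [s], [n] yields [un], and [tn] is a chord for the tips [u], [w]. *)
  have [wN|wN] := boolP (w \in NG e); last first.
    have ws' := F_e _ _ _ sF wN ws.
    by case/negP: nuw; apply: (@LUCS_P4 t u m s w) => //; rewrite e_sym.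
  have wsF := F_F _ _ _ sF wN ws.
  have [n tn /andP[nw ns]] := FG_common_edge wsF (introT andP (conj tw ts)).
  have un : e u n by apply: (@LUCS_P4 t u m s n) => //; rewrite e_sym.
  by apply/FGP; split=> //; exists t, n; rewrite tn tu tw nw e_sym un.
(* With the chord in [e], either [rim] applies to an [FG]-pair on the rim, or the diamond lies in
   [e]; both make [ab] an [FG]-pair. *)
case/orP: cd => [cd|cdF].
  have [dc nba] : e d c /\ ~~ e b a by rewrite [e d c]e_sym [e b a]e_sym.
  have ba : b != a by rewrite eq_sym.
  case/negP: nFab; case/orP: (ac) => [ac'|acF]; last exact: rim acF cd ab nab _ _ _.
  case/orP: (ad) => [ad'|adF]; last exact: rim adF dc ab nab _ _ _.
  case/orP: (bc) => [bc'|bcF]; last first.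
    by rewrite FG_sym; apply: rim bcF cd ba nba _ _ _.
  case/orP: (bd) => [bd'|bdF]; last first.
    by rewrite FG_sym; apply: rim bdF dc ba nba _ _ _.
  by apply/FGP; split=> //; exists c, d; rewrite cd ![e c _]e_sym ![e d _]e_sym ac' ad'
    bc' bd'.
have dcF : FG e d c by rewrite FG_sym.
(* The chord is now an [FG]-pair. Up to swapping the tips, both are outside [NG], only [a] is
   inside, or both are inside. *)
wlog: a b ab nab nFab ac ad bc bd / (a \in NG e) || (b \notin NG e).
  move=> W; have [aN|aN] := boolP (a \in NG e); first by apply: (W a b); rewrite ?aN.
  by apply: (W b a); rewrite // ?aN ?orbT // (eq_sym b, e_sym b, FG_sym b).
have eN z : z \notin NG e -> e z c || FG e z c -> e z d || FG e z d -> e z c && e z d.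
  by move=> zN zc zd; rewrite (F_e _ _ _ cdF zN zc) (F_e _ _ _ dcF zN zd).
have FN z : z \in NG e -> e z c || FG e z c -> e z d || FG e z d -> FG e z c /\ FG e d z.
  move=> zN zc zd; split; first exact: F_F cdF zN zc.
  by rewrite FG_sym; apply: F_F dcF zN zd.
have [aN _|aN /= bN] := boolP (a \in NG e); last first.
  by case/negP: nab; apply: FG_common_nbh_clique cdF (eN a _ _ _) (eN b _ _ _) ab.
have [acF daF] := FN _ aN ac ad.
have [bN|bN] := boolP (b \in NG e); last first.
  by case/negP: nab; rewrite e_sym; apply: FG_triangle_nbh acF cdF daF (eN b _ _ _).
have [bcF dbF] := FN _ bN bc bd.
(* Both ends of an edge common to [a], [c], [d] see [c] and [d], hence also [b], so [a] and [b] are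
   tips of a diamond of [e]. *)
have [v [k [vk /and3P[va vc vd] /and3P[ka kc kd]]]] :=
  FG_triangle_common_edge acF cdF daF.
have b_adj z : e z c -> e z d -> e z b.
  by move=> zc zd; apply: FG_triangle_nbh bcF cdF dbF _; rewrite zc.
by case/negP: nFab; apply/FGP; split=> //; exists v, k; rewrite vk va ka !b_adj.
Qed.

End LucsTheory.

(** * Necessity: consequences of a diamond-free completion by pairs inside a stable set [N] *)

Section Probe.

Variables (N : {set T}) (F : rel T).
Hypotheses (N_stable : is_stable e N) (F_sym : symmetric F).
Hypothesis F_N : forall x y, F x y -> [&& x \in N, y \in N, x != y & ~~ e x y].
Hypothesis diamond_freeF : free_of diamond [rel x y | e x y || F x y].

(** Within the neighbourhood of [c] in the completion, adjacency is transitive through [d]. *)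
Lemma completion_no_diamond a b c d : a != b -> e c d || F c d ->
  e a c || F a c -> e a d || F a d -> e b c || F b c -> e b d || F b d ->
  e a b || F a b.
Proof.
move=> ab cd ac ad bc bd; apply/contraT=> nab; case: diamond_freeF.
apply/has_induced_diamond; first by move=> x y; rewrite /= e_sym F_sym.
  move=> x; rewrite /= e_irr; apply/negP=> /F_N/and4P[_ _].
  by rewrite eqxx.
by exists a, b, c, d; rewrite /= ac ad bc bd.
Qed.

(** That transitivity, centred at [v], propagates along the edges of the component. *)
Lemma completion_component v C : C \in components e (nbh e v) ->
  {in C &, forall x y, x != y -> e x y || F x y}.
Proof.
move=> CA x y xC yC xy.
have : (x == y) || (e x y || F x y).
  apply: (component_ind (R := fun x y => (x == y) || (e x y || F x y)) CA)
    => // [u | u z w]; first by rewrite eqxx.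
  rewrite !inE => vu vz vw uz zw; have [//|uw /=] := eqVneq u w.
  case/orP: uz => [/eqP ->|uz]; first by rewrite zw.
  by apply: (completion_no_diamond (c := v) (d := z) uw);
    rewrite ?vz ?[e _ v]e_sym ?vu ?vw // [e w z]e_sym zw.
by rewrite (negPf xy).
Qed.

Lemma completion_notin x y : x \notin N -> e x y || F x y -> e x y.
Proof. by move=> xN /orP[//|/F_N/and4P[]]; rewrite (negPf xN). Qed.

Lemma nbh_notin x y : x \in N -> e x y -> y \notin N.
Proof.
move=> xN; apply: contraL => yN.
exact: (forall_inP (forall_inP N_stable x xN)).
Qed.

(** [C] is a clique of the completion and pairs of [F] lie inside [N], so vertices of [C] outside
    [N] see the rest of [C] in [e]. *)
Lemma probe_LUCS : LUCS e.
Proof.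
move=> v C CA; have CN := completion_component CA.
have adj : {in C :\: N & C, forall x y, x != y -> e x y}.
  move=> x y /setDP[xC xN] yC xy; apply: completion_notin xN _; exact: CN.
apply/existsP; have [CN0|CNn0] := eqVneq (C :&: N) set0; last first.
  exists (C :\: (C :&: N)); apply/existsP; exists (C :&: N).
  apply: cs_partition_setD; rewrite ?subsetIl //; last by rewrite setDIr setDv set0U.
  apply/forall_inP=> x /setIP[_ xN]; apply/forall_inP=> y /setIP[_ yN].
  exact: (forall_inP (forall_inP N_stable x xN)).
have [x xC] : exists x, x \in C.
  by case/componentsP: CA => x xA ->; exists x; rewrite inE xA connect0.
(* A component missing [N] is a clique, so any single vertex serves as the stable side. *)
exists (C :\ x); apply/existsP; exists [set x].
apply: cs_partition_setD; rewrite ?sub1set //.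
- by apply/set0Pn; exists x; rewrite inE.
- by apply/forall_inP=> y /set1P ->; apply/forall_inP=> z /set1P ->; rewrite e_irr.
move=> y z /setDP[yC _]; apply: adj; rewrite inE yC andbT.
by apply: contra_eqN CN0 => yN; apply/set0Pn; exists y; rewrite inE yC.
Qed.

Lemma FG_subrel_F x y : FG e x y -> F x y.
Proof.
case/and3P=> xy nxy /existsP[v /exists_inP[C CA /andP[xS yS]]].
have sSC := subsetP (Spart_sub probe_LUCS CA).
by have := completion_component CA (sSC _ xS) (sSC _ yS) xy; rewrite (negPf nxy).
Qed.

Lemma NG_sub_N : NG e \subset N.
Proof.
by apply/subsetP=> x; rewrite inE => /existsP[y /FG_subrel_F/F_N/and4P[]].
Qed.

Lemma probe_NG_stable : is_stable e (NG e).
Proof.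
have sN := subsetP NG_sub_N; apply/forall_inP=> x /sN xN.
by apply/forall_inP=> y /sN; apply: (forall_inP (forall_inP N_stable x xN)).
Qed.

(** The chord [ac] forces [xy] into [F]; then [xy] is a chord for the tips [a], [b]. As [a] has a
    neighbour in [N], it is outside [N], so [ab] would be an edge of [e]. *)
Lemma probe_no_P3K2 :
  free_of (graph_compl (graph_union (@path_graph 3) (@complete_graph 2))) e.
Proof.
case/(has_induced_compl_P3K2 e_sym e_irr) => a [b [c [x [y []]]]].
move=> ac /andP[nab nbc] /andP[xy nxy] /and3P[xa xb xc] /and3P[ya yb yc].
have xyF : F x y.
  have := completion_no_diamond (c := a) (d := c) xy.
  by rewrite ac xa xc ya yc (negPf nxy); apply.
have /and4P[xN _ _ _] := F_N xyF.
have ab : a != b by apply: contraNneq nbc => <-.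
have := completion_no_diamond (c := x) (d := y) ab.
rewrite xyF orbT ![e _ x]e_sym ![e _ y]e_sym xa xb ya yb => /(_ isT isT isT isT isT).
by move/(completion_notin (nbh_notin xN xa)); apply/negP.
Qed.

(** The vertices [x], [y], [z] are pairwise adjacent in the completion, so every common neighbour of
    [x] and [y] in [e] also sees [z]. *)
Lemma probe_no_C6 phi : free_of (@cycle_graph 6) (@GB T e phi).
Proof.
case/has_induced_C6_GB=> x [y [z [p [q [r []]]]]].
case/and3P=> /(subsetP NG_sub_N) xN _ /(subsetP NG_sub_N) zN.
case/and3P; rewrite !inE => /and3P[pA _ _] /and3P[qA _ _] /and3P[rA _ _].
case/and3P=> xp yp zp /and3P[yq zq xq] /and3P[zr xr yr].
have SF w C u t : C \in components e (nbh e w) -> u \in Spart e C -> t \in Spart e C ->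
    u != t -> e u t || F u t.
  move=> CA uS tS; have sSC := subsetP (Spart_sub probe_LUCS CA).
  by apply: (completion_component CA); apply: sSC.
have xy : x != y by apply: contraNneq xq => ->.
have yz : y != z by apply: contraNneq zp => <-.
have zx : z != x by apply: contraNneq zp => ->.
have [k vk kS] := Spart_common_edge probe_LUCS pA xp yp xy.
have [/andP[vx kx] /andP[vy ky]] := (kS x xp, kS y yp).
have z_adj w : e w x -> e w y -> e w z.
  move=> wx wy; have [wz|wz] := eqVneq w z;
    first by rewrite wz (negPf (forall_inP (forall_inP N_stable z zN) x xN)) in wx.
  have wN : w \notin N by apply: nbh_notin xN _; rewrite e_sym.
  apply: (completion_notin wN).
  apply: (@completion_no_diamond w z x y); rewrite ?wx ?wy //.
  - exact: SF pA _ _ xy.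
  - exact: SF rA _ _ zx.
  - by apply: SF qA _ _ _; rewrite // eq_sym.
(* Both [p.1] and [k] see [z], which puts [z] in the component [p.2]; being nonadjacent to [x], it
   lies on the stable side, a contradiction. *)
have zC : z \in p.2.
  have xC := subsetP (Spart_sub probe_LUCS pA) x xp.
  have kC : k \in p.2 by apply: component_closed pA xC _ _; [rewrite inE | rewrite e_sym].
  by apply: component_closed pA kC _ (z_adj _ kx ky); rewrite inE z_adj.
case/negP: zp; apply: (nonadj_Spart probe_LUCS pA zC _ zx).
  exact: (subsetP (Spart_sub probe_LUCS pA)).
exact: (forall_inP (forall_inP N_stable z zN)).
Qed.

End Probe.

End Components.

Theorem theorem3 (T : finType) (e : rel T) (e_sym : symmetric e)
    (e_irr : irreflexive e) (phi : T -> 'I_#|T|) (phi_bij : bijective phi) :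
  probe_diamond_free e <->
  [/\ LUCS e,
      free_of (graph_compl (graph_union (@path_graph 3) (@complete_graph 2))) e,
      is_stable e (NG e)
    & free_of (@cycle_graph 6) (@GB T e phi)].
Proof.
split=> [[P [N [F [_ _ N_stable [F_sym F_N] dF]]]]|[lucs no_P3K2 NG_stable no_C6]].
  split.
  - exact: (probe_LUCS e_sym e_irr N_stable F_sym F_N dF).
  - exact: (probe_no_P3K2 e_sym e_irr N_stable F_sym F_N dF).
  - exact: (probe_NG_stable e_sym e_irr N_stable F_sym F_N dF).
  - exact: (probe_no_C6 e_sym e_irr N_stable F_sym F_N dF).
exists (~: NG e), (NG e), (FG e); split.
- by rewrite setUC setUCr.
- by rewrite -setI_eq0 setIC setICr.
- exact: NG_stable.
- split=> [|x y xyF]; first exact: FG_sym.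
  case/and3P: (xyF) => -> -> _; rewrite (FG_NG xyF) (@FG_NG _ _ y x) //.
  by rewrite FG_sym.
- exact: FG_completion_diamond_free (bij_inj phi_bij) no_C6 NG_stable.
Qed.
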